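(* Let $\mathrm{Sample}_{m/n}$ denote Poisson subsampling of a dataset of size $n$ at rate $m/n$, and let $M$ denote the map taking the subsample indexed by $I$ to the pair $(\bar x,\bar y)$ with $\bar x=\frac1m\sum_{i\in I}x_i'+\mathcal N(0,(C_x\sigma_x/m)^2I)$, $\bar y=\frac1m\sum_{i\in I}y_i'+\mathcal N(0,(C_y\sigma_y/m)^2I)$, where $x_i'=f_1(x_i)/\max(1,\|f_1(x_i)\|_2/C_x)$ and $y_i'=y_i/\max(1,\|y_i\|_2/C_y)$ (i.e. one step of DPFMix). Then for all neighboring datasets $S,S'$ (where $S$ is obtained from $S'$ by removing one record), $$T\big(M\circ\mathrm{Sample}_{m/n}(S),\,M\circ\mathrm{Sample}_{m/n}(S')\big)\ \ge\ \tfrac{m}{n}G_{\sqrt{1/\sigma_x^2+1/\sigma_y^2}}+\big(1-\tfrac{m}{n}\big)\mathrm{Id}.$$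
   Context: Poisson subsampling at rate $p$: each index $i\in\{1,\dots,n\}$ is included independently with probability $p$. $f_1$ is a fixed feature map; $C_x,C_y,\sigma_x,\sigma_y>0$; $1\le m\le n$. For distributions $P,Q$, $T(P,Q)(\alpha)=\inf_\phi\{1-\mathbb{E}_Q[\phi]:\mathbb{E}_P[\phi]\le\alpha\}$ over rejection rules $\phi$ (the trade-off function). $G_\mu(\alpha)=\Phi(\Phi^{-1}(1-\alpha)-\mu)$ with $\Phi$ the standard normal CDF; $\mathrm{Id}(\alpha)=1-\alpha$. *)

(* Defs.v *)
From HB Require Import structures.
From mathcomp Require Import all_boot all_order all_algebra.
From mathcomp Require Import all_classical all_reals all_analysis.
Set Implicit Arguments. Unset Strict Implicit. Unset Printing Implicit Defensive.
Import Order.TTheory GRing.Theory Num.Theory.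
Import numFieldNormedType.Exports.
Local Open Scope classical_set_scope.
Local Open Scope ring_scope.

Section DPFMix.
Variable R : realType.

Definition norm2 (N : nat) (v : 'rV[R]_N) : R := Num.sqrt (\sum_(i < N) v ord0 i ^+ 2).

Definition clip (N : nat) (C : R) (v : 'rV[R]_N) : 'rV[R]_N :=
  (Num.max 1 (norm2 v / C))^-1 *: v.

Definition borel_fun (T : topologicalType) (f : T -> R) : Prop :=
  forall B : set R, measurable B -> <<s [set U : set T | open U] >> (f @^-1` B).

(* Iterated integral against the product of 1-d normal distributions
   N(mu_1, s^2) x ... x N(mu_N, s^2), i.e. expectation under the isotropic
   Gaussian N(mu, s^2 I_N) on R^N (the point being given as a list). *)
Fixpoint iter_gauss (mu : seq R) (s : R) (g : seq R -> \bar R) : \bar R :=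
  match mu with
  | [::] => g [::]
  | a :: mu' => (\int[normal_prob a s]_t iter_gauss mu' s (fun l => g (t :: l)))%E
  end.

Definition vec_of (N : nat) (l : seq R) : 'rV[R]_N := \row_(i < N) nth 0 l i.
Definition seq_of (N : nat) (v : 'rV[R]_N) : seq R := [seq v ord0 i | i <- enum 'I_N].

Definition gauss_pair_E (d k : nat) (mux : 'rV[R]_d) (sx : R) (muy : 'rV[R]_k) (sy : R)
  (phi : 'rV[R]_d * 'rV[R]_k -> R) : \bar R :=
  iter_gauss (seq_of mux) sx (fun lx =>
    iter_gauss (seq_of muy) sy (fun ly => (phi (vec_of d lx, vec_of k ly))%:E)).

(* Output distribution of M o Sample_p on dataset S, given through the
   expectation of a test function phi. Records are pairs (x_i, y_i). *)
Definition dpfmix_E (X : Type) (d k : nat) (f1 : X -> 'rV[R]_d)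
  (Cx Cy sigx sigy : R) (m : nat) (p : R) (S : seq (X * 'rV[R]_k))
  (phi : 'rV[R]_d * 'rV[R]_k -> R) : \bar R :=
  (\sum_(I : {set 'I_(size S)})
     (p ^+ #|I| * (1 - p) ^+ (size S - #|I|))%:E *
     gauss_pair_E
       (m%:R^-1 *: \sum_(i in I) clip Cx (f1 (tnth (in_tuple S) i).1))
       (Cx * sigx / m%:R)
       (m%:R^-1 *: \sum_(i in I) clip Cy (tnth (in_tuple S) i).2)
       (Cy * sigy / m%:R) phi)%E.

Definition rejection_rule (d k : nat) (phi : 'rV[R]_d * 'rV[R]_k -> R) : Prop :=
  borel_fun phi /\ (forall z, 0 <= phi z <= 1).

Definition tradeoff (d k : nat) (EP EQ : ('rV[R]_d * 'rV[R]_k -> R) -> \bar R)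
  (alpha : R) : \bar R :=
  ereal_inf [set (1 - EQ phi)%E | phi in
             [set phi | rejection_rule phi /\ (EP phi <= alpha%:E)%E]].

Definition Phi (x : R) : R := fine (normal_prob 0 1 `]-oo, x]%classic).
Definition Phi_inv (q : R) : R := sup [set x | Phi x <= q].

(* G_mu(alpha) = Phi(Phi^{-1}(1-alpha) - mu), with the limiting values at
   alpha = 0 (Phi^{-1}(1) = +oo) and alpha = 1 (Phi^{-1}(0) = -oo) *)
Definition Gmu (mu alpha : R) : R :=
  if alpha <= 0 then 1 else if 1 <= alpha then 0
  else Phi (Phi_inv (1 - alpha) - mu).

End DPFMix.

(* Main.v *)
Require Import Defs.
From HB Require Import structures.
From mathcomp Require Import all_boot all_order all_algebra.
From mathcomp Require Import all_classical all_reals all_analysis.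
From mathcomp Require Import measurable_realfun ring lra.
Set Implicit Arguments. Unset Strict Implicit. Unset Printing Implicit Defensive.
Import Order.TTheory GRing.Theory Num.Theory.
Import numFieldNormedType.Exports.
Local Open Scope classical_set_scope.
Local Open Scope ring_scope.

(** Adding the record [r] translates the Gaussian output law of a subsample by an
    amount that does not depend on the subsample: the clipped vectors of [r]
    divided by [m], whose whitened norm is some [mu <= sqrt (sigx^-2 + sigy^-2)].
    Neyman-Pearson, in the Lagrangian form
      E_Q phi <= lam E_P phi + (1 - Phi (t - mu)) - lam (1 - Phi t),
    therefore holds with one common multiplier [lam] for all subsamples.  As it is
    linear in the two expectations it averages over the subsample, which replaces
    the usual appeal to the convexity of [Gmu]; it remains to take
    [t = Phi^-1 (1 - alpha)]. *)

(** * One-dimensional normal laws *)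

(** Conditioning on the coin of [r] gives [E_Q phi = (1 - p) * E_P phi + p * b], where [b] is the
    expectation given that [r] is sampled; the first term yields the [Id] part, so the work lies in
    bounding [b]. For different subsamples the most powerful tests are different half-spaces of the
    output space, so no single test is compared with [phi]. What they share is the law of the
    standardised log-likelihood statistic: N(0,1) before the translation and N(mu,1) after it, with
    likelihood ratio [expR (mu * x - mu ^+ 2 / 2)] at the value [x]. Cutting at [x = t] thus gives
    the same [lam] everywhere, namely this ratio at [t]. The Gaussian on the output space is
    available only as an iterated integral along a list of coordinates. Change of measure, the law
    of a linear statistic and measurability are therefore all proved by induction on the
    coordinates, which is why one-dimensional affine changes of variable and convolutions are
    needed. *)

Section normal1d.
Context {R : realType}.
Implicit Types (m s a b w t tau delta : R) (f : R -> \bar R).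
Local Notation mu := (@lebesgue_measure R).

(** The Radon-Nikodym derivative and [normal_pdf] have the same integral over every measurable set,
    hence agree almost everywhere. *)
Lemma ge0_integral_normal_prob m s f :
  measurable_fun [set: R] f -> (forall x, 0 <= f x)%E ->
  (\int[normal_prob m s]_x f x =
   \int[mu]_x (f x * (normal_pdf m s x)%:E))%E.
Proof.
move=> mf f0.
have dom := normal_prob_dominates m s.
rewrite -(Radon_Nikodym_SigmaFinite.change_of_variables dom)//.
apply: ae_eq_integral => //.
- apply: emeasurable_funM => //.
  exact: measurable_int (Radon_Nikodym_SigmaFinite.f_integrable dom).
- by apply: emeasurable_funM => //; apply/measurable_EFinP; exact: measurable_normal_pdf.
- apply: ae_eqe_mul2l => /=.
  apply: integral_ae_eq => //=.
  + exact: Radon_Nikodym_SigmaFinite.f_integrable.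
  + by apply/measurable_EFinP; exact: measurable_normal_pdf.
  + by move=> E _ mE; rewrite -Radon_Nikodym_SigmaFinite.f_integral.
Qed.

Lemma measurable_affine b w : measurable_fun [set: R] (fun t : R => b + w * t).
Proof. by apply: measurable_funD => //; exact: measurable_funM. Qed.

Lemma affine_preimage_itv b w (x y : R) : 0 < w ->
  (fun t : R => b + w * t) @^-1` `]x, y]%classic = `](x - b) / w, (y - b) / w]%classic.
Proof.
move=> w0; apply/seteqP; split => t /=;
  by rewrite !in_itv/= ltr_pdivrMr// ler_pdivlMr// ltrBlDl lerBrDl (mulrC t).
Qed.

(** By uniqueness of Lebesgue measure: its image under the affine map, scaled by [w], gives
    half-open intervals their length. *)
Lemma ge0_integral_pos_affine b w f : 0 < w ->
  measurable_fun [set: R] f -> (forall x, 0 <= f x)%E ->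
  (\int[mu]_x f x = w%:E * \int[mu]_x f (b + w * x)%R)%E.
Proof.
move=> w0 mf f0.
pose phi : measurableTypeR R -> measurableTypeR R := fun t : R => b + w * t.
have mphi : measurable_fun setT phi by exact: measurable_affine.
pose nu : {measure set (measurableTypeR R) -> \bar R} :=
  measure_function_pushforward__canonical__measure_function_Measure mu mphi.
pose k : {nonneg R} := NngNum (ltW w0).
rewrite -[X in (_ * X)%E](@ge0_integral_pushforward _ _ _ _ _ phi mphi mu setT)//.
transitivity (\int[mscale k nu]_x f x)%E; last first.
  by rewrite ge0_integral_mscale.
apply: eq_measure_integral => /= A mA _.
apply: (lebesgue_measure_unique (mu := mscale k nu)) => //= _ [[x y]] _ <-.
rewrite /mscale/= /nu /pushforward/= /phi affine_preimage_itv// !lebesgue_measure_itv/=.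
rewrite !lte_fin ltr_pM2r ?invr_gt0// ltrD2r.
case: ifPn => _; last by rewrite mule0.
rewrite -!EFinD -EFinM; congr EFin.
by field; rewrite gt_eqF.
Qed.

Lemma ge0_integral_opp f :
  measurable_fun [set: R] f -> (forall x, 0 <= f x)%E ->
  (\int[mu]_x f x = \int[mu]_x f (- x)%R)%E.
Proof.
move=> mf f0.
rewrite -[RHS](@ge0_integral_pushforward _ _ _ _ _
  (-%R : measurableTypeR R -> measurableTypeR R) _ mu setT)//.
by apply: eq_measure_integral => /= A mA _; rewrite lebesgue_measureN.
Qed.

Lemma ge0_integral_affine b w f : w != 0 ->
  measurable_fun [set: R] f -> (forall x, 0 <= f x)%E ->
  (\int[mu]_x f x = `|w|%:E * \int[mu]_x f (b + w * x)%R)%E.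
Proof.
move=> w0 mf f0; have [wgt|wlt|/esym/eqP] := ltgtP 0 w; last by rewrite (negbTE w0).
  by rewrite gtr0_norm//; exact: ge0_integral_pos_affine.
rewrite ltr0_norm// (@ge0_integral_pos_affine b (- w))// ?oppr_gt0//; congr (_ * _)%E.
rewrite [LHS]ge0_integral_opp//=; last first.
  by apply: measurableT_comp => //; exact: measurable_affine.
by apply: eq_integral => x _; rewrite mulrNN.
Qed.

Lemma normal_pdfN m s : normal_pdf m (- s) = normal_pdf m s :> (R -> R).
Proof.
apply/funext => x; rewrite /normal_pdf oppr_eq0; case: ifP => // _.
by rewrite /normal_peak /normal_fun sqrrN.
Qed.

(** An affine map of slope [w] produces the scale [w * s], possibly negative, whereas a variance
    only returns its absolute value through [Num.sqrt]. *)
Lemma integral_normal_prob_norm m s f :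
  (\int[normal_prob m `|s|]_x f x = \int[normal_prob m s]_x f x)%E.
Proof.
have [_//|_] := ger0P s.
by apply: eq_measure_integral => A _ _; rewrite /= /normal_prob normal_pdfN.
Qed.

Lemma normal_pdf_affine m s b w x : w != 0 -> s != 0 ->
  `|w| * normal_pdf (b + w * m) (w * s) (b + w * x) = normal_pdf m s x.
Proof.
move=> w0 s0; rewrite !normal_pdfE ?mulf_neq0//.
rewrite mulrA; congr (_ * _).
  rewrite /normal_peak exprMn -mulrA -mulrnAr sqrtrM ?sqr_ge0// sqrtr_sqr.
  by rewrite invfM mulrA divff ?mul1r// normr_eq0.
rewrite /normal_fun; congr expR; field.
by rewrite s0 w0.
Qed.

Lemma ge0_integral_normal_affine m s b w f : w != 0 -> s != 0 ->
  measurable_fun [set: R] f -> (forall x, 0 <= f x)%E ->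
  (\int[normal_prob m s]_x f (b + w * x)%R =
   \int[normal_prob (b + w * m) (w * s)]_x f x)%E.
Proof.
move=> w0 s0 mf f0.
rewrite [LHS]ge0_integral_normal_prob//; last first.
  by apply: (measurableT_comp mf); exact: measurable_affine.
rewrite [RHS](ge0_integral_normal_prob _ _ mf f0).
rewrite [RHS](@ge0_integral_affine b w _ w0); last 2 first.
- by apply: emeasurable_funM => //; apply/measurable_EFinP; exact: measurable_normal_pdf.
- by move=> x; rewrite mule_ge0// lee_fin normal_pdf_ge0.
rewrite -ge0_integralZl//; last 2 first.
- apply: emeasurable_funM; first by apply: (measurableT_comp mf); exact: measurable_affine.
  apply/measurable_EFinP; apply: measurableT_comp; first exact: measurable_normal_pdf.
  exact: measurable_affine.
- by move=> x _; rewrite mule_ge0// lee_fin normal_pdf_ge0.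
apply: eq_integral => x _.
by rewrite muleCA -EFinM normal_pdf_affine.
Qed.

(* Completing the square in [t]. *)
Lemma normal_pdf_mul_affine m w tau a s x t : tau != 0 -> s != 0 ->
  normal_pdf (m + w * t) tau x * normal_pdf a s t =
  normal_pdf (m + w * a) (Num.sqrt (tau ^+ 2 + w ^+ 2 * s ^+ 2)) x *
  normal_pdf (a + w * s ^+ 2 * (x - m - w * a) / (tau ^+ 2 + w ^+ 2 * s ^+ 2))
    (tau * s / Num.sqrt (tau ^+ 2 + w ^+ 2 * s ^+ 2)) t.
Proof.
move=> t0 s0.
have v0 : 0 < tau ^+ 2 + w ^+ 2 * s ^+ 2.
  by rewrite ltr_wpDr ?exprn_even_gt0// mulr_ge0// sqr_ge0.
set v := tau ^+ 2 + _ in v0 *.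
have sv0 : Num.sqrt v != 0 by rewrite gt_eqF// sqrtr_gt0.
have vn0 : v != 0 by rewrite gt_eqF.
have svv : Num.sqrt v ^+ 2 = v by rewrite sqr_sqrtr// ltW.
rewrite !normal_pdfE ?mulf_neq0 ?invr_neq0// /normal_peak /normal_fun.
rewrite mulrACA [RHS]mulrACA -!invfM -!expRD; congr (_^-1 * expR _).
  have pg y : 0 <= y ^+ 2 * (pi : R) *+ 2.
    by rewrite mulrn_wge0// mulr_ge0 ?pi_ge0// sqr_ge0.
  rewrite -!sqrtrM//; congr Num.sqrt.
  by rewrite exprMn exprVn exprMn svv; field.
rewrite exprMn exprVn exprMn svv /v; field.
by rewrite exprMn vn0 s0 t0.
Qed.

Lemma measurable_normal_pdf2 m w tau : tau != 0 ->
  measurable_fun [set: R * R] (fun z : R * R => normal_pdf (m + w * z.1) tau z.2).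
Proof.
move=> t0; under eq_fun do rewrite normal_pdfE//.
apply: measurable_funM => //; apply: measurableT_comp => //.
apply: measurable_funM => //; apply: measurableT_comp => //.
apply: measurable_funX; apply: measurable_funB; first exact: measurable_snd.
by apply: measurable_funD => //; apply: measurable_funM => //; exact: measurable_fst.
Qed.

(** Variances of independent normals add up. Tonelli exchanges the integrals; once the square is
    completed, the inner integral is that of a probability density in [t]. *)
Lemma normal_convolution m w tau a s f : tau != 0 -> s != 0 ->
  measurable_fun [set: R] f -> (forall x, 0 <= f x)%E ->
  (\int[normal_prob a s]_t \int[normal_prob (m + w * t) tau]_x f x =
   \int[normal_prob (m + w * a) (Num.sqrt (tau ^+ 2 + w ^+ 2 * s ^+ 2))]_x f x)%E.
Proof.
move=> t0 s0 mf f0.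
have mg : measurable_fun [set: R * R] (fun z : R * R =>
    (f z.2 * (normal_pdf (m + w * z.1) tau z.2)%:E)%E).
  apply: emeasurable_funM; first exact: measurableT_comp.
  by apply/measurable_EFinP; exact: measurable_normal_pdf2.
have g0 z : (0 <= f z.2 * (normal_pdf (m + w * z.1) tau z.2)%:E)%E.
  by rewrite mule_ge0// lee_fin normal_pdf_ge0.
under eq_integral do rewrite ge0_integral_normal_prob//.
rewrite [LHS]ge0_integral_normal_prob; last 2 first.
- exact: (@measurable_fun_fubini_tonelli_F _ _ _ _ _ mu _ mg g0).
- by move=> t; apply: integral_ge0 => x _; exact: (g0 (t, x)).
transitivity (\int[mu]_t \int[mu]_x (f x * (normal_pdf (m + w * t) tau x)%:E *
    (normal_pdf a s t)%:E))%E.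
  apply: eq_integral => t _; rewrite ge0_integralZr// ?lee_fin ?normal_pdf_ge0//.
  - by apply: emeasurable_funM => //; apply/measurable_EFinP; exact: measurable_normal_pdf.
  - by move=> x _; exact: (g0 (t, x)).
pose h (z : R * R) := (f z.2 * (normal_pdf (m + w * z.1) tau z.2)%:E *
    (normal_pdf a s z.1)%:E)%E.
rewrite (@fubini_tonelli _ _ _ _ _ mu mu h); last 2 first.
- apply: emeasurable_funM => //; apply/measurable_EFinP.
  by apply: measurableT_comp; [exact: measurable_normal_pdf|exact: measurable_fst].
- by move=> z; rewrite mule_ge0// lee_fin normal_pdf_ge0.
rewrite [RHS]ge0_integral_normal_prob//; apply: eq_integral => x _.
rewrite /h/=.
under eq_integral do rewrite -muleA -EFinM normal_pdf_mul_affine// EFinM muleA.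
rewrite ge0_integralZl//.
- by rewrite integral_normal_pdf mule1.
- by apply/measurable_EFinP; exact: measurable_normal_pdf.
- by move=> y _; rewrite lee_fin normal_pdf_ge0.
- by rewrite mule_ge0// lee_fin normal_pdf_ge0.
Qed.

Lemma normal_pdf_shift a s delta t : s != 0 ->
  normal_pdf (a + delta) s t =
  expR (delta / s ^+ 2 * t - (delta / s ^+ 2 * a + delta ^+ 2 / s ^+ 2 / 2))
    * normal_pdf a s t.
Proof.
move=> s0; rewrite !normal_pdfE// mulrCA; congr (_ * _).
rewrite /normal_fun -expRD; congr expR.
by field.
Qed.

(** Change of measure: the log-likelihood ratio of two normal laws with equal variance is affine in
    [t]. *)
Lemma ge0_integral_normal_shift a s delta f : s != 0 ->
  measurable_fun [set: R] f -> (forall x, 0 <= f x)%E ->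
  (\int[normal_prob (a + delta) s]_t f t =
   \int[normal_prob a s]_t ((expR (delta / s ^+ 2 * t -
      (delta / s ^+ 2 * a + delta ^+ 2 / s ^+ 2 / 2)))%:E * f t))%E.
Proof.
move=> s0 mf f0; rewrite !ge0_integral_normal_prob//.
- by apply: eq_integral => t _; rewrite normal_pdf_shift// EFinM muleCA muleA.
- apply: emeasurable_funM => //; apply/measurable_EFinP; apply: measurableT_comp => //.
  by apply: measurable_funB => //; exact: measurable_funM.
- by move=> t; rewrite mule_ge0// lee_fin expR_ge0.
Qed.

End normal1d.

(** * The standard normal distribution function *)

Section Phi_facts.
Context {R : realType}.
Implicit Types (m t x y q alpha mu : R).
Local Notation leb := (@lebesgue_measure R).

Lemma fin_num_normal_prob m s (A : set R) : measurable A ->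
  normal_prob m s A \is a fin_num.
Proof. by move=> mA; exact: fin_num_measure. Qed.

Lemma PhiE x : (Phi x)%:E = normal_prob 0 1 `]-oo, x]%classic.
Proof. by rewrite fineK// fin_num_normal_prob. Qed.

Lemma Phi_le1 x : Phi x <= 1.
Proof. by rewrite -lee_fin PhiE probability_le1. Qed.

Lemma Phi_nondecreasing : {homo @Phi R : x y / x <= y}.
Proof.
move=> x y xy; rewrite -lee_fin !PhiE le_measure ?inE//.
exact: subset_itvl.
Qed.

Lemma normal_prob_tail t : normal_prob 0 1 `]t, +oo[%classic = (1 - Phi t)%:E.
Proof.
rewrite -setCitvl probability_setC; last exact: measurable_itv.
by rewrite EFinB PhiE.
Qed.

Lemma normal_prob_tail_shift m t :
  normal_prob m 1 `]t, +oo[%classic = (1 - Phi (t - m))%:E.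
Proof.
pose f (x : R) : \bar R := (\1_(`]t, +oo[%classic : set R) x)%:E.
have mf : measurable_fun [set: R] f by exact/measurable_EFinP/measurable_indic.
have f0 x : (0 <= f x)%E by rewrite lee_fin.
have := @ge0_integral_normal_affine R 0 1 m 1 f (oner_neq0 _) (oner_neq0 _) mf f0.
rewrite mulr0 addr0 mulr1. rewrite [X in _ = X]integral_indic// setIT => <-.
under eq_integral => x _.
  have -> : f (m + 1 * x) = (\1_(`]t - m, +oo[%classic : set R) x)%:E.
    by rewrite /f !indicE; congr (_%:R%:E); rewrite !mem_setE !in_itv/= !andbT mul1r ltrBlDl.
  over.
by rewrite integral_indic//= setIT normal_prob_tail.
Qed.

(** The density is bounded by its peak. This supplies the continuity with which [Phi] is evaluated
    at a supremum. *)
Lemma Phi_lipschitz x y : x <= y -> Phi y - Phi x <= normal_peak 1 * (y - x).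
Proof.
move=> xy; rewrite -lee_fin EFinB !PhiE.
have -> : `]-oo, y]%classic = `]-oo, x]%classic `|` `]x, y]%classic :> set R.
  by rewrite -itv_bndbnd_setU// bnd_simp.
rewrite measureU//=; last first.
  apply/seteqP; split => z //= [].
  by rewrite !in_itv/= => zx /andP[/lt_le_trans/(_ zx)]; rewrite ltxx.
rewrite addeAC subee ?fin_num_normal_prob// add0e.
apply: (@le_trans _ _ (\int[leb]_(z in `]x, y]) (normal_peak 1)%:E)%E).
  apply: ge0_le_integral => //=.
  - by move=> z _; rewrite lee_fin normal_pdf_ge0.
  - by apply/measurable_EFinP/measurable_funTS; exact: measurable_normal_pdf.
  - by move=> z _; rewrite lee_fin normal_pdf_ub// oner_neq0.
rewrite integral_cst//= lebesgue_measure_itv/= lte_fin.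
by case: ltP => // yx; rewrite mule0 lee_fin mulr_ge0 ?normal_peak_ge0// subr_ge0.
Qed.

(** The identity seen as a random variable: its cumulative distribution function is [Phi], which
    inherits the limits at infinity. *)
Let idX : {RV (normal_prob (0 : R) 1) >-> R} :=
  HB.pack (idfun : measurableTypeR R -> R)
    (@isMeasurableFun.Build _ _ _ _ (idfun : measurableTypeR R -> R)
       (@measurable_id _ _ setT)).

Let fine_cdf_idX : fine \o cdf idX = @Phi R.
Proof. by []. Qed.

Lemma Phi_cvg0 : Phi x @[x --> -oo%R] --> (0 : R).
Proof. by rewrite -fine_cdf_idX; exact/fine_cvg/cvg_cdfNy0. Qed.

Lemma Phi_cvg1 : Phi x @[x --> +oo%R] --> (1 : R).
Proof. by rewrite -fine_cdf_idX; exact/fine_cvg/cvg_cdfy1. Qed.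

(** The set defining [Phi_inv q] has points within [e / normal_peak 1] of its supremum, and over
    that distance [Phi] grows by less than [e]. *)
Lemma Phi_Phi_inv_le q : 0 < q < 1 -> Phi (Phi_inv q) <= q.
Proof.
move=> /andP[q0 q1].
have [x0 hx0] : exists x, Phi x <= q.
  by have /cvgr_le/(_ _ q0)/filter_ex := Phi_cvg0.
have [x1 hx1] : exists x, q < Phi x.
  by have /cvgr_gt/(_ _ q1)/filter_ex := Phi_cvg1.
have hs : has_sup [set x | Phi x <= q].
  split; first by exists x0.
  exists x1 => x /= xq; rewrite leNgt; apply/negP => x1x.
  have := Phi_nondecreasing (ltW x1x).
  by rewrite leNgt (le_lt_trans xq hx1).
apply/ler_addgt0Pr => e e0.
have k0 : 0 < normal_peak (1 : R) by rewrite normal_peak_gt0// oner_neq0.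
have [x /= xq xe] := sup_adherent (divr_gt0 e0 k0) hs.
have xs : x <= Phi_inv q by exact: sup_upper_bound.
have := Phi_lipschitz xs.
rewrite -/(Phi_inv q) in xe.
have : normal_peak 1 * (Phi_inv q - x) < e.
  by rewrite mulrC -ltr_pdivlMr//; lra.
lra.
Qed.

End Phi_facts.

(** * Products of normal laws, integrated along lists *)

Section gauss_list.
Context {R : realType}.
Implicit Types (ms : seq (R * R)) (ws l : seq R) (g : seq R -> \bar R).

(** Each coordinate carries its own mean and standard deviation, so that the two output blocks,
    whose scales differ, form one list. *)
Fixpoint igauss ms g : \bar R :=
  match ms with
  | [::] => g [::]
  | p :: ms' => (\int[normal_prob p.1 p.2]_t igauss ms' (fun l => g (t :: l)))%E
  end.

Definition all_measurable d (T : measurableType d) (us : seq (T -> R)) :=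
  forall i, measurable_fun [set: T] (nth (cst 0) us i).

Definition evals (T : Type) (us : seq (T -> R)) (x : T) : seq R := [seq u x | u <- us].

(* Borel measurability in the first [n] entries, tested on all families of [n]
   measurable coordinates: this avoids a sigma-algebra on lists. *)
Definition seq_measurable (n : nat) g :=
  forall d (T : measurableType d) (us : seq (T -> R)),
    size us = n -> all_measurable us -> measurable_fun [set: T] (g \o evals us).

Lemma all_measurable_comp d1 d2 (T1 : measurableType d1) (T2 : measurableType d2)
    (h : T1 -> T2) (us : seq (T2 -> R)) : measurable_fun [set: T1] h ->
  all_measurable us -> all_measurable [seq u \o h | u <- us].
Proof.
move=> mh mus i; have [lti|gei] := ltnP i (size us).
  by rewrite (nth_map (cst 0))//; exact: measurableT_comp.
by rewrite nth_default ?size_map//; exact: measurable_cst.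
Qed.

Lemma all_measurable_rcons d (T : measurableType d) (us : seq (T -> R)) (u : T -> R) :
  all_measurable us -> measurable_fun [set: T] u -> all_measurable (rcons us u).
Proof.
move=> mus mu i; rewrite nth_rcons; case: ifP => // _; case: ifP => // _.
Qed.

Lemma all_measurable_cons d (T : measurableType d) (us : seq (T -> R)) (u : T -> R) :
  all_measurable us -> measurable_fun [set: T] u -> all_measurable (u :: us).
Proof. by move=> mus mu [|i] //=; exact: mus. Qed.

(** The induction moves the integration variable into the parameter space, replacing [T] by [T * R],
    and Tonelli's theorem integrates it out. This is why [seq_measurable] quantifies over all
    measurable spaces. *)
Lemma measurable_igauss_evals ms n g d (T : measurableType d) (us : seq (T -> R)) :
  (forall l, 0 <= g l)%E -> seq_measurable n g -> (size us + size ms = n)%N ->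
  all_measurable us ->
  measurable_fun [set: T] (fun x => igauss ms (fun l => g (evals us x ++ l))).
Proof.
move=> g0 mg; elim: ms d T us => [|[a s] ms IH] d T us /= sz mus.
  under eq_fun do rewrite cats0.
  by apply: mg => //; rewrite -sz addn0.
pose us' := rcons [seq u \o (@fst T R) | u <- us] (@snd T R).
have mus' : all_measurable us'.
  apply: all_measurable_rcons; last exact: measurable_snd.
  by apply: all_measurable_comp => //; exact: measurable_fst.
have sz' : (size us' + size ms = n)%N by rewrite size_rcons size_map addSnnS.
have := IH _ _ us' sz' mus'.
set f := (fun x : T * R => _) => mf.
have f0 z : (0 <= f z)%E.
  rewrite /f; move: (evals us' z); elim: (ms) => [|p ms' IH'] l /=; first exact: g0.
  by apply: integral_ge0 => t _; under eq_fun do rewrite -cat_rcons; exact: IH'.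
have := @measurable_fun_fubini_tonelli_F _ _ _ _ _ (normal_prob a s) _ mf f0.
congr (measurable_fun _ _); apply/funext => x; rewrite /fubini_F.
apply: eq_integral => t _; rewrite /f; congr igauss; apply/funext => l.
rewrite /us' /evals map_rcons cat_rcons -map_comp.
by congr (g (_ ++ _)).
Qed.

Lemma igauss_ge0 ms g : (forall l, 0 <= g l)%E -> (0 <= igauss ms g)%E.
Proof.
elim: ms g => [|p ms IH] g g0 //=; apply: integral_ge0 => t _.
by apply: IH => l; exact: g0.
Qed.

Lemma eq_igauss ms g1 g2 : g1 =1 g2 -> igauss ms g1 = igauss ms g2.
Proof. by move=> g12; congr igauss; exact/funext. Qed.

Lemma seq_measurable_cons n g t : seq_measurable n.+1 g ->
  seq_measurable n (fun l => g (t :: l)).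
Proof.
move=> mg d T us sz mus; apply: (mg _ T (cst t :: us)); first by rewrite /= sz.
by apply: all_measurable_cons => //; exact: measurable_cst.
Qed.

Lemma measurable_igauss_cons ms g : (forall l, 0 <= g l)%E ->
  seq_measurable (size ms).+1 g ->
  measurable_fun [set: R] (fun t => igauss ms (fun l => g (t :: l))).
Proof.
move=> g0 mg.
apply: (@measurable_igauss_evals ms _ g _ _ [:: (@idfun R)] g0 mg) => //.
apply: all_measurable_cons; last exact: measurable_id.
by move=> i; rewrite nth_nil; exact: measurable_cst.
Qed.

Lemma igauss_cst ms (c : R) : igauss ms (cst c%:E) = c%:E.
Proof.
elim: ms => [|p ms IH] //=.
under eq_integral do rewrite [igauss _ _]IH.
by rewrite integral_cst// [X in (_ * X)%E]probability_setT mule1.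
Qed.

Lemma igaussD ms g1 g2 : (forall l, 0 <= g1 l)%E -> (forall l, 0 <= g2 l)%E ->
  seq_measurable (size ms) g1 -> seq_measurable (size ms) g2 ->
  igauss ms (fun l => g1 l + g2 l)%E = (igauss ms g1 + igauss ms g2)%E.
Proof.
elim: ms g1 g2 => [|p ms IH] g1 g2 g10 g20 mg1 mg2 //=.
rewrite -ge0_integralD//=.
- by apply: eq_integral => t _; apply: IH => //; exact: seq_measurable_cons.
- by move=> t _; exact: igauss_ge0.
- exact: measurable_igauss_cons.
- by move=> t _; exact: igauss_ge0.
- exact: measurable_igauss_cons.
Qed.

Lemma igaussZl ms (k : R) g : 0 <= k -> (forall l, 0 <= g l)%E ->
  seq_measurable (size ms) g ->
  igauss ms (fun l => k%:E * g l)%E = (k%:E * igauss ms g)%E.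
Proof.
move=> k0; elim: ms g => [|p ms IH] g g0 mg //=.
rewrite -ge0_integralZl//=.
- by apply: eq_integral => t _; apply: IH => //; exact: seq_measurable_cons.
- exact: measurable_igauss_cons.
- by move=> t _; exact: igauss_ge0.
Qed.

Lemma le_igauss ms g1 g2 : (forall l, 0 <= g1 l)%E -> (forall l, g1 l <= g2 l)%E ->
  seq_measurable (size ms) g1 -> seq_measurable (size ms) g2 ->
  (igauss ms g1 <= igauss ms g2)%E.
Proof.
elim: ms g1 g2 => [|p ms IH] g1 g2 g10 g12 mg1 mg2 //=.
have g20 l : (0 <= g2 l)%E by exact: le_trans (g12 l).
apply: ge0_le_integral => //=.
- by move=> t _; exact: igauss_ge0.
- exact: measurable_igauss_cons.
- exact: measurable_igauss_cons.
- by move=> t _; apply: IH => //; exact: seq_measurable_cons.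
Qed.

Lemma igauss_cat ms1 ms2 (h : seq R -> seq R -> \bar R) :
  igauss ms1 (fun l1 => igauss ms2 (h l1)) =
  igauss (ms1 ++ ms2) (fun l => h (take (size ms1) l) (drop (size ms1) l)).
Proof.
elim: ms1 h => [|p ms1 IH] h /=.
  by apply: eq_igauss => l; rewrite take0 drop0.
by apply: eq_integral => t _; rewrite (IH (fun l1 => h (t :: l1))).
Qed.

Lemma iter_gaussE (mu : seq R) s g :
  iter_gauss mu s g = igauss [seq (a, s) | a <- mu] g.
Proof. by elim: mu g => [//|a mu IH] g /=; apply: eq_integral => t _; rewrite IH. Qed.

Definition dot ws l : R := \sum_(p <- zip ws l) p.1 * p.2.

Lemma dot_nil l : dot [::] l = 0.
Proof. by rewrite /dot; case: l => [|? ?]; rewrite big_nil. Qed.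

Lemma dot_cons w ws x l : dot (w :: ws) (x :: l) = w * x + dot ws l.
Proof. by rewrite /dot /= big_cons. Qed.

Lemma measurable_dot_evals ws d (T : measurableType d) (us : seq (T -> R)) :
  all_measurable us -> measurable_fun [set: T] (fun x => dot ws (evals us x)).
Proof.
elim: ws us => [|w ws IH] [|u us] mus.
- by rewrite (_ : (fun x => _) = cst 0)//; apply/funext => x; exact: dot_nil.
- by rewrite (_ : (fun x => _) = cst 0)//; apply/funext => x; exact: dot_nil.
- by rewrite (_ : (fun x => _) = cst 0)//; apply/funext => x; rewrite /dot big_nil.
- under eq_fun do rewrite /= dot_cons.
  apply: measurable_funD; first by apply: measurable_funM => //; exact: (mus 0).
  by apply: IH => i; exact: (mus i.+1).
Qed.

Lemma seq_measurable_dot n ws (f : R -> \bar R) : measurable_fun [set: R] f ->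
  seq_measurable n (f \o dot ws).
Proof.
by move=> mf d T us _ mus; apply: (measurableT_comp mf); exact: measurable_dot_evals.
Qed.

Lemma seq_measurableM n g1 g2 : seq_measurable n g1 -> seq_measurable n g2 ->
  seq_measurable n (fun l => g1 l * g2 l)%E.
Proof.
by move=> m1 m2 d T us sz mus; apply: emeasurable_funM; [exact: m1|exact: m2].
Qed.

Lemma seq_measurableD n g1 g2 : seq_measurable n g1 -> seq_measurable n g2 ->
  seq_measurable n (fun l => g1 l + g2 l)%E.
Proof.
by move=> m1 m2 d T us sz mus; apply: emeasurable_funD; [exact: m1|exact: m2].
Qed.

Lemma seq_measurable_cst n (c : \bar R) : seq_measurable n (cst c).
Proof. by move=> d T us _ _; exact: measurable_cst. Qed.

End gauss_list.

(** * The Neyman-Pearson bound for a translated Gaussian *)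

Section neyman_pearson.
Context {R : realType}.
Implicit Types (ms : seq (R * R)) (prm : seq (R * R * R)) (ws l : seq R).

(** A linear form in independent normals is normal: the tail is integrated with the head term
    absorbed into [c], then convolved with the head. When [v] is 0 the form is constant, a point
    mass that [normal_prob] does not represent. *)
Lemma igauss_dot ms ws (c : R) (f : R -> \bar R) :
  measurable_fun [set: R] f -> (forall x, 0 <= f x)%E ->
  {in ms, forall p : R * R, p.2 != 0} -> size ws = size ms ->
  let m := c + dot ws (unzip1 ms) in
  let v := \sum_(p <- zip ws ms) (p.1 * p.2.2) ^+ 2 in
  igauss ms (fun l => f (c + dot ws l)) =
  if v == 0 then f m else (\int[normal_prob m (Num.sqrt v)]_x f x)%E.
Proof.
move=> mf f0; elim: ms ws c => [|[a s] ms IH] [|w ws] c //= s0.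
  by move=> _; rewrite big_nil eqxx !dot_nil.
move=> [sz]; have sn0 : s != 0 by exact: (s0 (a, s) (mem_head _ _)).
have {}s0 : {in ms, forall p : R * R, p.2 != 0}.
  by move=> p pm; apply: s0; rewrite inE pm orbT.
rewrite big_cons/= dot_cons.
under eq_integral => t _.
  under eq_igauss do rewrite dot_cons addrA.
  rewrite IH//; over.
set v := \sum_(p <- _) _; set d := dot _ _.
have v0 : 0 <= v by rewrite sumr_ge0// => p _; rewrite sqr_ge0.
have [vE|vn0] /= := eqVneq v 0.
(* The tail is constant, so the head alone is random: an affine change of variable replaces the
   convolution. *)
- rewrite vE addr0 sqrf_eq0 mulf_eq0 (negbTE sn0) orbF.
  have [->|w0] := eqVneq w 0.
    under eq_integral do rewrite mul0r addr0.
    rewrite integral_cst// [X in (_ * X)%E]probability_setT mule1.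
    by rewrite mul0r add0r.
  transitivity (\int[normal_prob a s]_t f (c + d + w * t)%R)%E.
    by apply: eq_integral => t _; congr f; rewrite addrAC.
  apply: (etrans (@ge0_integral_normal_affine R a s (c + d) w f w0 sn0 mf f0)).
  rewrite sqrtr_sqr.
  have -> : c + d + w * a = c + (w * a + d) by ring.
  exact: esym (integral_normal_prob_norm _ _ _).
- rewrite paddr_eq0 ?sqr_ge0// (negbTE vn0) andbF.
  have sv0 : Num.sqrt v != 0 by rewrite sqrtr_eq0 -ltNge lt0r vn0.
  transitivity (\int[normal_prob a s]_t
      \int[normal_prob (c + d + w * t) (Num.sqrt v)]_x f x)%E.
    apply: eq_integral => t _.
    by have -> : c + w * t + d = c + d + w * t by ring.
  apply: (etrans (@normal_convolution R (c + d) w (Num.sqrt v) a s f sv0 sn0 mf f0)).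
  rewrite (sqr_sqrtr v0) exprMn [v + _]addrC.
  by have -> : c + d + w * a = c + (w * a + d) by ring.
Qed.

(** An entry of [prm] describes one coordinate as ((mean, standard deviation), shift of the
    mean). *)
Definition nominal prm := [seq q.1 | q <- prm].
Definition shifted prm := [seq (q.1.1 + q.2, q.1.2) | q <- prm].
(** The gradient of the log-likelihood ratio of the shifted law against the nominal one. *)
Definition score prm := [seq q.2 / q.1.2 ^+ 2 | q <- prm].
(** The squared Mahalanobis norm of the shift, which is also the variance of [dot (score prm)] under
    either law. *)
Definition shift_info prm : R := \sum_(q <- prm) q.2 ^+ 2 / q.1.2 ^+ 2.

Lemma seq_measurable_expR_dot n ws (c : R) :
  seq_measurable n (fun l => (expR (dot ws l - c))%:E).
Proof.
apply: (@seq_measurable_dot _ n ws (fun x => (expR (x - c))%:E)).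
apply/measurable_EFinP; apply: measurableT_comp => //.
exact: measurable_funB.
Qed.

(** The one-dimensional likelihood ratios multiply, so their exponents add up along the list. *)
Lemma igauss_shifted prm g : {in prm, forall q : R * R * R, q.1.2 != 0} ->
  (forall l, 0 <= g l)%E -> seq_measurable (size prm) g ->
  igauss (shifted prm) g =
  igauss (nominal prm) (fun l => (expR (dot (score prm) l -
    (dot (score prm) (unzip1 (nominal prm)) + shift_info prm / 2)))%:E * g l)%E.
Proof.
rewrite /shift_info.
elim: prm g => [|[[a s] delta] prm IH] g s0 g0 mg /=.
  by rewrite big_nil !dot_nil mul0r addr0 subr0 expR0 mul1e.
have sn0 : s != 0 by exact: (s0 (a, s, delta) (mem_head _ _)).
have {}s0 q : q \in prm -> q.1.2 != 0 by move=> qp; apply: s0; rewrite inE qp orbT.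
have szn : size (nominal prm) = size prm by rewrite size_map.
have szs : size (shifted prm) = size prm by rewrite size_map.
rewrite ge0_integral_normal_shift//; last 2 first.
- by apply: measurable_igauss_cons => //; rewrite szs.
- by move=> t; exact: igauss_ge0.
apply: eq_integral => t _; rewrite IH//; last exact: seq_measurable_cons.
rewrite -igaussZl ?expR_ge0//.
- apply: eq_igauss => l; rewrite muleA -EFinM -expRD big_cons !dot_cons/=.
  by congr ((expR _)%:E * _)%E; ring.
- by move=> l; rewrite mule_ge0// lee_fin expR_ge0.
- rewrite szn; apply: seq_measurableM; first exact: seq_measurable_expR_dot.
  exact: seq_measurable_cons.
Qed.

Lemma dot_map (I : Type) (s : seq I) (f h : I -> R) :
  dot [seq f i | i <- s] [seq h i | i <- s] = \sum_(i <- s) f i * h i.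
Proof.
elim: s => [|i s IH] /=; first by rewrite dot_nil big_nil.
by rewrite dot_cons IH big_cons.
Qed.

Lemma dotZ k ws l : dot [seq k * w | w <- ws] l = k * dot ws l.
Proof.
elim: ws l => [|w ws IH] [|x l] /=; rewrite ?dot_nil ?mulr0//.
- by rewrite /dot big_nil mulr0.
- by rewrite !dot_cons IH mulrDr mulrA.
Qed.

Lemma igauss_fin01 ms (phi : seq R -> R) : (forall l, 0 <= phi l <= 1) ->
  seq_measurable (size ms) (EFin \o phi) ->
  (0 <= igauss ms (EFin \o phi) <= 1)%E.
Proof.
move=> phi01 mphi; rewrite igauss_ge0/=; last first.
  by move=> l; rewrite lee_fin; have /andP[] := phi01 l.
rewrite -[leRHS](igauss_cst ms 1); apply: le_igauss => //.
- by move=> l; rewrite lee_fin; have /andP[] := phi01 l.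
- by move=> l; rewrite lee_fin; have /andP[] := phi01 l.
- exact: seq_measurable_cst.
Qed.

(** Pointwise Neyman-Pearson: [(L - lam) * (b%:R - phi)] is nonnegative, because [b] is true exactly
    where [L] exceeds [lam]. *)
Lemma likelihood_ratio_test (L lam phi : R) (b : bool) : 0 <= phi <= 1 ->
  b = (lam < L) -> L * phi + lam * b%:R <= L * b%:R + lam * phi.
Proof.
move=> /andP[p0 p1] ->; have [h|h] := ltP lam L.
- have : 0 <= (L - lam) * (1 - phi) by rewrite mulr_ge0 ?subr_ge0// ltW.
  by rewrite /= !mulr1; nra.
- have : 0 <= (lam - L) * phi by rewrite mulr_ge0 ?subr_ge0.
  by rewrite /= !mulr0; nra.
Qed.

(** Integrates the pointwise inequality against the test [psi], which rejects when the score,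
    centred under the nominal law and divided by [mu], exceeds [t]. The terms are arranged so that
    no subtraction of extended reals occurs. *)
Lemma igauss_shifted_le prm (phi : seq R -> R) (t mu lam : R) :
  {in prm, forall q : R * R * R, q.1.2 != 0} -> (forall l, 0 <= phi l <= 1) ->
  seq_measurable (size prm) (EFin \o phi) ->
  mu = Num.sqrt (shift_info prm) -> lam = expR (mu * t - mu ^+ 2 / 2) ->
  (igauss (shifted prm) (EFin \o phi) + (lam * (1 - Phi t))%:E <=
   lam%:E * igauss (nominal prm) (EFin \o phi) + (1 - Phi (t - mu))%:E)%E.
Proof.
move=> s0 phi01 mphi muE lamE.
have I0 : 0 <= shift_info prm.
  by apply: sumr_ge0 => q _; rewrite divr_ge0 ?sqr_ge0.
have phi0 l : (0 <= (EFin \o phi) l)%E.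
  by rewrite lee_fin; have /andP[] := phi01 l.
have mu2 : mu ^+ 2 = shift_info prm by rewrite muE sqr_sqrtr.
(* The statistic cannot be divided by [mu = 0]; but then every shift vanishes, [lam] is 1 and the
   two sides coincide. *)
have [mu0|mun0] := eqVneq mu 0.
  have -> : shifted prm = nominal prm.
    apply/eq_in_map => -[[a s] delta] qp /=.
    have := mu2; rewrite mu0 expr0n/= => /esym/eqP.
    rewrite psumr_eq0; last by move=> q _; rewrite divr_ge0 ?sqr_ge0.
    move=> /allP/(_ _ qp)/=; rewrite mulf_eq0 invr_eq0 !sqrf_eq0.
    by rewrite (negbTE (s0 _ qp)) orbF => /eqP ->; rewrite addr0.
  by rewrite lamE mu0 mul0r expr0n/= mul0r subr0 expR0 mul1e mul1r subr0.
have mugt0 : 0 < mu by rewrite lt_def mun0 muE sqrtr_ge0.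
have lam0 : 0 < lam by rewrite lamE expR_gt0.
pose ws := [seq mu^-1 * w | w <- score prm].
pose c := - dot ws (unzip1 (nominal prm)).
pose f (x : R) : \bar R := (\1_(`]t, +oo[%classic : set R) x)%:E.
have mf : measurable_fun [set: R] f by exact/measurable_EFinP/measurable_indic.
have f0 x : (0 <= f x)%E by rewrite lee_fin.
pose psi l := f (c + dot ws l).
have psi0 l : (0 <= psi l)%E by exact: f0.
have mpsi n : seq_measurable n psi.
  apply: (@seq_measurable_dot _ n ws (fun x => f (c + x))).
  by apply: (measurableT_comp mf); exact: measurable_funD.
have szn : size (nominal prm) = size prm by rewrite size_map.
have szs : size (shifted prm) = size prm by rewrite size_map.
have wsE : ws = [seq mu^-1 * (q.2 / q.1.2 ^+ 2) | q <- prm] by rewrite /ws -map_comp.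
(* The means [h] are left free: the statistic has variance 1 under the nominal and the shifted law
   alike. *)
have var1 (h : R * R * R -> R) :
    \sum_(p <- zip ws [seq (h q, q.1.2) | q <- prm]) (p.1 * p.2.2) ^+ 2 = 1.
  rewrite wsE.
  have -> : zip [seq mu^-1 * (q.2 / q.1.2 ^+ 2) | q <- prm] [seq (h q, q.1.2) | q <- prm]
      = [seq (mu^-1 * (q.2 / q.1.2 ^+ 2), (h q, q.1.2)) | q <- prm].
    by elim: (prm) => //= ? ? ->.
  rewrite big_map/=; transitivity ((mu ^+ 2)^-1 * shift_info prm); last first.
    by rewrite mu2 mulVf// -mu2 expf_neq0.
  rewrite /shift_info mulr_sumr big_seq [RHS]big_seq.
  by apply: eq_bigr => q qp; field; rewrite mun0 (s0 _ qp).
have Ppsi : igauss (nominal prm) psi = (1 - Phi t)%:E.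
  rewrite igauss_dot//; last 2 first.
  - by move=> p /mapP[q qp ->]; exact: s0.
  - by rewrite !size_map.
  have -> : nominal prm = [seq (q.1.1, q.1.2) | q <- prm].
    by apply: eq_map => -[[]].
  rewrite var1 oner_eq0 sqrtr1.
  rewrite [X in normal_prob X](_ : _ = 0).
    rewrite integral_indic// setIT; exact: normal_prob_tail.
  rewrite /c; have -> : nominal prm = [seq (q.1.1, q.1.2) | q <- prm].
    by apply: eq_map => -[[]].
  by rewrite addNr.
have Qpsi : igauss (shifted prm) psi = (1 - Phi (t - mu))%:E.
  rewrite igauss_dot//; last 2 first.
  - by move=> p /mapP[q qp ->]; exact: s0.
  - by rewrite !size_map.
  rewrite var1 oner_eq0 sqrtr1.
  rewrite [X in normal_prob X](_ : _ = mu).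
    rewrite integral_indic// setIT; exact: normal_prob_tail_shift.
  (* The shift moves the mean of the statistic from 0 to [mu^-1 * shift_info prm], that is [mu]. *)
  rewrite /c /unzip1 -!map_comp wsE !dot_map -sumrN -big_split/=.
  transitivity (mu^-1 * shift_info prm); last by rewrite -mu2 expr2 mulKf.
  rewrite /shift_info mulr_sumr; apply: eq_bigr => q _; ring.
pose L l := expR (dot (score prm) l -
  (dot (score prm) (unzip1 (nominal prm)) + shift_info prm / 2)).
have shE g : (forall l, 0 <= g l)%E -> seq_measurable (size prm) g ->
    igauss (shifted prm) g = igauss (nominal prm) (fun l => (L l)%:E * g l)%E.
  by move=> g0 mg; exact: igauss_shifted.
rewrite -Qpsi EFinM -Ppsi !shE//.
(* The likelihood ratio increases with the statistic and equals [lam] where the statistic is [t];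
   hence [psi] rejects exactly where [lam < L l]. *)
have LE l : L l = expR (mu * (c + dot ws l) - mu ^+ 2 / 2).
  by rewrite /L /c /ws !dotZ -mu2; congr expR; field.
have mL n : seq_measurable n (EFin \o L) by exact: seq_measurable_expR_dot.
have L0 l : (0 <= (L l)%:E)%E by rewrite lee_fin expR_ge0.
rewrite -!igaussZl ?(ltW lam0) ?szn//.
have mLM g : seq_measurable (size prm) g -> seq_measurable (size prm) (fun l => (L l)%:E * g l)%E.
  by move=> mg; exact: seq_measurableM.
have mlM g : seq_measurable (size prm) g -> seq_measurable (size prm) (fun l => lam%:E * g l)%E.
  by move=> mg; apply: seq_measurableM => //; exact: seq_measurable_cst.
have lg0 g : (forall l, 0 <= g l)%E -> forall l : seq R, (0 <= lam%:E * g l)%E.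
  by move=> g0 l; rewrite mule_ge0// lee_fin ltW.
have Lg0 g : (forall l, 0 <= g l)%E -> forall l : seq R, (0 <= (L l)%:E * g l)%E.
  by move=> g0 l; rewrite mule_ge0.
rewrite -!igaussD ?szn//; try exact: lg0; try exact: Lg0;
  try exact: mlM; try exact: mLM.
apply: le_igauss; rewrite ?szn.
- by move=> l; apply: adde_ge0; [exact: Lg0|exact: lg0].
- move=> l; rewrite /psi /f /= -!EFinM -!EFinD lee_fin [leRHS]addrC indicE.
  apply: likelihood_ratio_test => //.
  rewrite mem_setE in_itv/= andbT LE lamE ltr_expR.
  by rewrite ltrD2r ltr_pM2l.
- by apply: seq_measurableD; [exact: mLM|exact: mlM].
- by apply: seq_measurableD; [exact: mlM|exact: mLM].
Qed.

End neyman_pearson.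

(** * Borel rejection rules *)

Section borel_rules.
Context {R : realType}.

Definition split_vec (d k : nat) (l : seq R) : 'rV[R]_d * 'rV[R]_k :=
  (vec_of d (take d l), vec_of k (drop d l)).

(** Balls of row vectors are boxes for the sup distance, so membership is a finite conjunction of
    one-dimensional conditions. *)
Lemma ball_rV_preimage_measurable d (T : measurableType d) N (us : nat -> T -> R)
    (x : 'rV[R]_N) (e : R) : 0 < e ->
  (forall i, measurable_fun [set: T] (us i)) ->
  measurable [set t | ball x e (\row_(i < N) us i t)].
Proof.
move=> e0 mus.
have -> : [set t | ball x e (\row_(i < N) us i t)] =
    \bigcap_(i in [set: 'I_N]) (us i @^-1` ball (x ord0 i) e).
  apply/seteqP; split => t /=.
    by move=> [_ H] i _ /=; have := H ord0 i; rewrite mxE.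
  by move=> H; split => // i j; rewrite (ord1 i) mxE; exact: (H j).
apply: fin_bigcap_measurable => // i _.
rewrite -[X in measurable X]setTI; apply: mus => //.
exact: measurable_ball.
Qed.

Lemma exists_rat_rV N (x : 'rV[R]_N) (e : R) : 0 < e ->
  exists q : 'rV[rat]_N, ball (map_mx ratr q : 'rV[R]_N) e x.
Proof.
move=> e0.
have H i : exists q : rat, ball (ratr q : R) e (x ord0 i).
  have [q] := @rat_in_itvoo R (x ord0 i - e) (x ord0 i + e) ltac:(lra).
  rewrite in_itv/= => /andP[h1 h2]; exists q; rewrite /ball/= ltr_norml.
  by apply/andP; split; lra.
have [f hf] := choice H.
by exists (\row_i f i); split => // i j; rewrite (ord1 i) !mxE; exact: hf.
Qed.

(** Second countability: an open set is the union of the balls inside it with rational centre and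
    radius [1/(n+1)]. This reconciles the topological sigma-algebra of [borel_fun] with
    coordinatewise measurability. *)
Lemma open_preimage_measurable d (T : measurableType d) N M
    (us vs : nat -> T -> R) (U : set ('rV[R]_N * 'rV[R]_M)) :
  open U ->
  (forall i, measurable_fun [set: T] (us i)) ->
  (forall i, measurable_fun [set: T] (vs i)) ->
  measurable [set t | U (\row_(i < N) us i t, \row_(i < M) vs i t)].
Proof.
move=> oU mus mvs.
pose c (q : 'rV[rat]_N * 'rV[rat]_M) : 'rV[R]_N * 'rV[R]_M :=
  (map_mx ratr q.1, map_mx ratr q.2).
pose h t : 'rV[R]_N * 'rV[R]_M := (\row_(i < N) us i t, \row_(i < M) vs i t).
pose box (s : ('rV[rat]_N * 'rV[rat]_M) * nat) := ball (c s.1) (s.2.+1%:R^-1 : R).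
rewrite (_ : [set _ | _] = \bigcup_s
    [set t | box s `<=` U /\ box s (h t)]); last first.
  apply/seteqP; split => t /=; last by move=> [s _ [/= sU /sU]].
  rewrite -/(h t) => Ut.
  have /nbhs_ballP[e /= e0 eU] : nbhs (h t) U by exact: open_nbhs_nbhs.
  (* Two points of a ball of radius below [e / 2] lie within [e] of each other, so a ball containing
     [h t] stays inside [U]. *)
  have [n ne] : exists n : nat, n.+1%:R^-1 < e / 2.
    have [n _ H] := near_infty_natSinv_lt (PosNum (divr_gt0 e0 (ltr0n _ 2))).
    by exists n; exact: (H n (leqnn n)).
  have n0 : 0 < n.+1%:R^-1 :> R by rewrite invr_gt0 ltr0n.
  have [q1 hq1] := exists_rat_rV (h t).1 n0.
  have [q2 hq2] := exists_rat_rV (h t).2 n0.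
  have bt : box ((q1, q2), n) (h t) by split.
  exists ((q1, q2), n) => //; split => // z bz.
  apply: eU; apply: (@ball_splitr _ _ (c (q1, q2))).
    by apply: le_ball bt; exact: ltW.
  by apply: le_ball bz; exact: ltW.
apply: countable_bigcupT_measurable => [|s]; first exact: countableP.
have [sU|sU] := pselect (box s `<=` U); last first.
  rewrite (_ : [set _ | _] = set0)//.
  by apply/seteqP; split => t //= [].
rewrite (_ : [set _ | _] = [set t | ball (c s.1).1 (s.2.+1%:R^-1) (h t).1] `&`
    [set t | ball (c s.1).2 (s.2.+1%:R^-1) (h t).2]); last first.
  by apply/seteqP; split => t /=; [move=> [_ []]|move=> []].
by apply: measurableI; apply: ball_rV_preimage_measurable; rewrite ?invr_gt0 ?ltr0n.
Qed.

Lemma borel_fun_seq_measurable (d k : nat) (phi : 'rV[R]_d * 'rV[R]_k -> R) :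
  borel_fun phi -> seq_measurable (d + k) (EFin \o (phi \o split_vec d k)).
Proof.
move=> bphi disp T us sz mus.
apply/measurable_EFinP.
pose W := g_sigma_algebraType [set U : set ('rV[R]_d * 'rV[R]_k) | open U].
pose h : T -> W := fun t => split_vec d k (evals us t).
have mh : measurable_fun [set: T] h.
  apply: (@measurability _ _ T W setT h [set U : set ('rV[R]_d * 'rV[R]_k) | open U]) => //.
  move=> _ [U oU <-]; rewrite setTI.
  have -> : h @^-1` U = [set t | U (\row_(i < d) (nth (cst 0) us i) t,
      \row_(i < k) (nth (cst 0) us (d + i)%N) t)].
    apply/seteqP; rewrite /h /split_vec /vec_of /preimage.
    suff E t : (\row_(i < d) nth 0 (take d (evals us t)) i,
        \row_(i < k) nth 0 (drop d (evals us t)) i) =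
      (\row_(i < d) (nth (cst 0) us i) t, \row_(i < k) (nth (cst 0) us (d + i)%N) t).
      by split => t /=; rewrite E.
    congr pair; apply/rowP => i; rewrite !mxE.
      by rewrite nth_take// (nth_map (cst 0))// sz ltn_addr.
    by rewrite nth_drop (nth_map (cst 0))// sz ltn_add2l.
  by apply: (@open_preimage_measurable _ T d k (nth (cst 0) us)
    (fun i => nth (cst 0) us (d + i)%N)) => // i; exact: mus.
have mphi : measurable_fun [set: W] (phi : W -> R).
  by move=> _ B mB; rewrite setTI; exact: bphi.
exact: (measurableT_comp mphi mh).
Qed.

End borel_rules.

(** * Poisson subsampling *)

Section poisson_sampling.
Context {R : realType} (E : Type) (V : zmodType) (u : E -> V).
Implicit Types (p : R) (S : seq E) (F G : V -> R).

(** Expectation of [F] at the sum of [u] over a Poisson subsample, written one coin at a time so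
    that a single record can be isolated. *)
Fixpoint sampE p S F : R :=
  if S is r :: S' then (1 - p) * sampE p S' F + p * sampE p S' (fun v => F (u r + v))
  else F 0.

Lemma eq_sampE p S F G : F =1 G -> sampE p S F = sampE p S G.
Proof. by move=> FG; congr sampE; exact/funext. Qed.

(** Addition is commutative and the coins are independent, so the coin of [r] may be tossed first
    wherever [r] stands. *)
Lemma sampE_insert p S1 r S2 F :
  sampE p (S1 ++ r :: S2) F = (1 - p) * sampE p (S1 ++ S2) F +
    p * sampE p (S1 ++ S2) (fun v => F (u r + v)).
Proof.
elim: S1 F => [//|r1 S1 IH] F /=; rewrite !IH.
have -> : sampE p (S1 ++ S2) (fun v => F (u r1 + (u r + v))) =
    sampE p (S1 ++ S2) (fun v => F (u r + (u r1 + v))).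
  by apply: eq_sampE => v; rewrite addrCA.
ring.
Qed.

(** The sampling weights are nonnegative and sum to 1, so an affine bound with constants common to
    all subsamples survives averaging. *)
Lemma sampE_le_affine p S F G (a b : R) : 0 <= p <= 1 ->
  (forall v, G v <= a * F v + b) -> sampE p S G <= a * sampE p S F + b.
Proof.
move=> /andP[p0 p1]; elim: S F G => [|r S IH] F G FG /=; first exact: FG.
have h1 := IH _ _ FG.
have h2 := IH (fun v => F (u r + v)) (fun v => G (u r + v)) (fun v => FG (u r + v)).
have q0 : 0 <= 1 - p by rewrite subr_ge0.
have := lerD (ler_wpM2l q0 h1) (ler_wpM2l p0 h2); move/le_trans; apply.
by rewrite le_eqVlt; apply/orP; left; apply/eqP; ring.
Qed.

Lemma sum_set_ordS n (H : {set 'I_n.+1} -> R) :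
  \sum_(I : {set 'I_n.+1}) H I =
  \sum_(J : {set 'I_n}) H (lift ord0 @: J) +
  \sum_(J : {set 'I_n}) H (ord0 |: lift ord0 @: J).
Proof.
have n0 (J : {set 'I_n}) : ord0 \notin lift ord0 @: J.
  by apply/imsetP => -[j _ /eqP]; rewrite eq_sym lift_eqF.
have mem_lift (J : {set 'I_n}) j : (lift ord0 j \in lift ord0 @: J) = (j \in J).
  by rewrite mem_imset//; exact: lift_inj.
rewrite (bigID (fun I : {set 'I_n.+1} => ord0 \notin I))/=; congr (_ + _).
- rewrite (reindex_onto (fun J : {set 'I_n} => lift ord0 @: J)
    (fun I : {set 'I_n.+1} => [set j | lift ord0 j \in I]%SET)).
    apply: eq_bigl => J; rewrite n0/=; apply/eqP/setP => j.
    by rewrite inE mem_lift.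
  move=> I I0; apply/setP => i; have [j ->|->] := unliftP ord0 i.
    by rewrite mem_lift inE.
  by rewrite (negbTE (n0 _)) (negbTE I0).
- rewrite (reindex_onto (fun J : {set 'I_n} => ord0 |: lift ord0 @: J)
    (fun I : {set 'I_n.+1} => [set j | lift ord0 j \in I]%SET)).
    apply: eq_bigl => J; rewrite setU11/=; apply/eqP/setP => j.
    by rewrite !inE lift_eqF mem_lift.
  move=> I; rewrite negbK => I0; apply/setP => i.
  have [j ->|->] := unliftP ord0 i.
    by rewrite !inE lift_eqF mem_lift inE.
  by rewrite setU11 I0.
Qed.

Lemma sampE_sum p S F :
  \sum_(I : {set 'I_(size S)}) p ^+ #|I| * (1 - p) ^+ (size S - #|I|) *
    F (\sum_(i in I) u (tnth (in_tuple S) i)) = sampE p S F.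
Proof.
elim: S F => [|r S IH] F.
  rewrite (big_pred1 finset.set0); last first.
    by move=> I; apply/esym/eqP/setP => -[].
  by rewrite cards0 big_set0 subn0 !expr0 !mul1r.
have sumE (J : {set 'I_(size S)}) :
    \sum_(i in J) u (tnth (in_tuple (r :: S)) (lift ord0 i)) =
    \sum_(i in J) u (tnth (in_tuple S) i).
  by apply: eq_bigr => i _; rewrite !(tnth_nth r).
rewrite sum_set_ordS /= -!IH !mulr_sumr; congr (_ + _).
- apply: eq_bigr => J _; rewrite card_imset; last exact: lift_inj.
  rewrite big_imset/=; last by move=> ? ? _ _; exact: lift_inj.
  (* Subtraction on [nat] is truncated: this bound is what makes the exponent of [1 - p] grow by one
     for the excluded head. *)
  have Jle : (#|J| <= size S)%N by rewrite -[leqRHS]card_ord max_card.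
  rewrite subSn// exprS.
  rewrite sumE.
  ring.
- apply: eq_bigr => J _.
  have n0 : ord0 \notin lift ord0 @: J.
    by apply/imsetP => -[j _ /eqP]; rewrite eq_sym lift_eqF.
  rewrite cardsU1 n0 card_imset; last exact: lift_inj.
  rewrite big_setU1//= big_imset/=; last by move=> ? ? _ _; exact: lift_inj.
  rewrite add1n subSS exprS (tnth_nth r)/=.
  rewrite sumE.
  ring.
Qed.

End poisson_sampling.

(** * One step of DPFMix *)

Section dpfmix.
Context {R : realType} (d k : nat).
Implicit Types (phi : 'rV[R]_d * 'rV[R]_k -> R) (C s : R).

Lemma norm2_ge0 N (v : 'rV[R]_N) : 0 <= norm2 v.
Proof. exact: sqrtr_ge0. Qed.

Lemma norm2Z N c (v : 'rV[R]_N) : norm2 (c *: v) = `|c| * norm2 v.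
Proof.
rewrite /norm2 -sqrtr_sqr -sqrtrM ?sqr_ge0// mulr_sumr; congr Num.sqrt.
by apply: eq_bigr => i _; rewrite mxE exprMn.
Qed.

Lemma norm2_clip_le N C (v : 'rV[R]_N) : 0 < C -> norm2 (clip C v) <= C.
Proof.
move=> C0; rewrite norm2Z.
have m0 : 0 < Num.max 1 (norm2 v / C) by rewrite lt_max ltr01.
rewrite gtr0_norm ?invr_gt0// mulrC ler_pdivrMr// mulrC -ler_pdivrMr//.
by rewrite le_max lexx orbT.
Qed.

Definition shift_params (mux dx : 'rV[R]_d) (sx : R) (muy dy : 'rV[R]_k) (sy : R) :
    seq (R * R * R) :=
  [seq (mux ord0 i, sx, dx ord0 i) | i <- enum 'I_d] ++
  [seq (muy ord0 i, sy, dy ord0 i) | i <- enum 'I_k].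

Lemma size_seq_of N (v : 'rV[R]_N) : size (seq_of v) = N.
Proof. by rewrite /seq_of size_map fintype.size_enum_ord. Qed.

Lemma gauss_pairE mux sx muy sy phi :
  gauss_pair_E mux sx muy sy phi =
  igauss ([seq (a, sx) | a <- seq_of mux] ++ [seq (b, sy) | b <- seq_of muy])
    (EFin \o (phi \o split_vec d k)).
Proof.
rewrite /gauss_pair_E iter_gaussE.
under eq_igauss do rewrite iter_gaussE.
rewrite (@igauss_cat R [seq (a, sx) | a <- seq_of mux] [seq (b, sy) | b <- seq_of muy]
  (fun lx ly => (phi (vec_of d lx, vec_of k ly))%:E)).
have sz : size [seq (a, sx) | a <- seq_of mux] = d.
  by rewrite size_map size_seq_of.
by apply: eq_igauss => l; rewrite /= /split_vec sz.
Qed.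

Lemma gauss_pair_nominal mux dx sx muy dy sy phi :
  gauss_pair_E mux sx muy sy phi =
  igauss (nominal (shift_params mux dx sx muy dy sy)) (EFin \o (phi \o split_vec d k)).
Proof.
rewrite gauss_pairE /nominal /shift_params map_cat.
by congr (igauss (_ ++ _) _); rewrite /seq_of -!map_comp.
Qed.

Lemma gauss_pair_shifted mux dx sx muy dy sy phi :
  gauss_pair_E (mux + dx) sx (muy + dy) sy phi =
  igauss (shifted (shift_params mux dx sx muy dy sy)) (EFin \o (phi \o split_vec d k)).
Proof.
rewrite gauss_pairE /shifted /shift_params map_cat.
by congr (igauss (_ ++ _) _); rewrite /seq_of -!map_comp; apply: eq_map => i /=;
  rewrite mxE.
Qed.

Lemma shift_info_params mux dx sx muy dy sy :
  shift_info (shift_params mux dx sx muy dy sy) =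
  norm2 dx ^+ 2 / sx ^+ 2 + norm2 dy ^+ 2 / sy ^+ 2.
Proof.
have H N (v w : 'rV[R]_N) s :
    \sum_(q <- [seq (v ord0 i, s, w ord0 i) | i <- enum 'I_N]) q.2 ^+ 2 / q.1.2 ^+ 2 =
    norm2 w ^+ 2 / s ^+ 2.
  rewrite big_map big_enum/= -mulr_suml /norm2 sqr_sqrtr//.
  by apply: sumr_ge0 => i _; rewrite sqr_ge0.
by rewrite /shift_info /shift_params big_cat/= !H.
Qed.

Lemma size_shift_params mux dx sx muy dy sy :
  size (shift_params mux dx sx muy dy sy) = (d + k)%N.
Proof. by rewrite /shift_params size_cat 2!size_map !fintype.size_enum_ord. Qed.

Lemma shift_params_neq0 mux dx sx muy dy sy : sx != 0 -> sy != 0 ->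
  {in shift_params mux dx sx muy dy sy, forall q : R * R * R, q.1.2 != 0}.
Proof.
by move=> x0 y0 q; rewrite mem_cat => /orP[] /mapP[i _ ->].
Qed.

Lemma rejection_rule_split phi : rejection_rule phi ->
  seq_measurable (d + k) (EFin \o (phi \o split_vec d k)) /\
  (forall l, 0 <= (phi \o split_vec d k) l <= 1).
Proof.
by move=> [bphi phi01]; split; [exact: borel_fun_seq_measurable|move=> l; exact: phi01].
Qed.

Lemma gauss_pair_fin01 mux sx muy sy phi : rejection_rule phi ->
  gauss_pair_E mux sx muy sy phi = (fine (gauss_pair_E mux sx muy sy phi))%:E /\
  0 <= fine (gauss_pair_E mux sx muy sy phi) <= 1.
Proof.
move=> /rejection_rule_split[mphi phi01].
have : (0 <= gauss_pair_E mux sx muy sy phi <= 1)%E.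
  rewrite gauss_pairE; apply: igauss_fin01 => //.
  by rewrite size_cat 2!size_map !size_seq_of.
by case: gauss_pair_E => [r| |] //=; rewrite ?andbF// !lee_fin.
Qed.

Lemma gauss_pair_shift_le mux dx sx muy dy sy phi (t mu lam : R) :
  rejection_rule phi -> sx != 0 -> sy != 0 ->
  mu = Num.sqrt (norm2 dx ^+ 2 / sx ^+ 2 + norm2 dy ^+ 2 / sy ^+ 2) ->
  lam = expR (mu * t - mu ^+ 2 / 2) ->
  fine (gauss_pair_E (mux + dx) sx (muy + dy) sy phi) <=
  lam * fine (gauss_pair_E mux sx muy sy phi) +
    ((1 - Phi (t - mu)) - lam * (1 - Phi t)).
Proof.
move=> rphi sx0 sy0 muE lamE.
have [mphi phi01] := rejection_rule_split rphi.
have [E1 _] := gauss_pair_fin01 (mux + dx) sx (muy + dy) sy rphi.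
have [E2 _] := gauss_pair_fin01 mux sx muy sy rphi.
have := @igauss_shifted_le _ (shift_params mux dx sx muy dy sy)
  (phi \o split_vec d k) t mu lam
  (@shift_params_neq0 mux dx sx muy dy sy sx0 sy0) phi01.
rewrite size_shift_params shift_info_params => /(_ mphi muE lamE).
rewrite -gauss_pair_nominal -gauss_pair_shifted E1 E2 -!EFinM -!EFinD lee_fin.
by lra.
Qed.

(** * The release as a function of the sum of clipped records *)

Section mixture.
Variables (X : Type) (f1 : X -> 'rV[R]_d) (Cx Cy sigx sigy : R) (m : nat).

Definition clipped_record (r : X * 'rV[R]_k) : 'rV[R]_d * 'rV[R]_k :=
  (clip Cx (f1 r.1), clip Cy r.2).

(** Taking the sum [v] before division by [m] as argument turns the addition of a record into a
    translation. [fine] loses nothing on rejection rules, whose expectations lie in [0,1]. *)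
Definition release_E phi (v : 'rV[R]_d * 'rV[R]_k) : R :=
  fine (gauss_pair_E (m%:R^-1 *: v.1) (Cx * sigx / m%:R)
    (m%:R^-1 *: v.2) (Cy * sigy / m%:R) phi).

Lemma dpfmix_sampE p S phi : rejection_rule phi ->
  dpfmix_E f1 Cx Cy sigx sigy m p S phi =
  (sampE clipped_record p S (release_E phi))%:E.
Proof.
move=> rphi; rewrite -sampE_sum /dpfmix_E -sumEFin; apply: eq_bigr => I _.
rewrite [RHS]EFinM /release_E.
have fst_sum : (\sum_(i in I) clipped_record (tnth (in_tuple S) i)).1 =
    \sum_(i in I) clip Cx (f1 (tnth (in_tuple S) i).1).
  by apply: (big_morph (fun v => v.1)).
have snd_sum : (\sum_(i in I) clipped_record (tnth (in_tuple S) i)).2 =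
    \sum_(i in I) clip Cy (tnth (in_tuple S) i).2.
  by apply: (big_morph (fun v => v.2)).
rewrite fst_sum snd_sum; congr (_ * _)%E.
by have [] := gauss_pair_fin01 (m%:R^-1 *: \sum_(i in I) clip Cx (f1 (tnth (in_tuple S) i).1))
  (Cx * sigx / m%:R) (m%:R^-1 *: \sum_(i in I) clip Cy (tnth (in_tuple S) i).2)
  (Cy * sigy / m%:R) rphi.
Qed.

(** The order of the quantifiers is the point: [mu] is chosen before [t], and [lam] before [v], so
    that the bound can be averaged over subsamples. *)
Lemma release_E_shift_le phi (r : X * 'rV[R]_k) : rejection_rule phi ->
  0 < Cx -> 0 < Cy -> 0 < sigx -> 0 < sigy -> (0 < m)%N ->
  exists2 mu, 0 <= mu <= Num.sqrt (sigx ^-2 + sigy ^-2) &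
  forall t, exists2 lam, 0 < lam & forall v,
    release_E phi (clipped_record r + v) <=
    lam * release_E phi v + ((1 - Phi (t - mu)) - lam * (1 - Phi t)).
Proof.
move=> rphi Cx0 Cy0 sx0 sy0 m0.
have mR0 : 0 < m%:R :> R by rewrite ltr0n.
(* Clipping limits the shift to [C / m] against noise of scale [C * s / m]; both [C] and [m]
   cancel. *)
have bound N (v : 'rV[R]_N) C s : 0 < C -> 0 < s ->
    norm2 (m%:R^-1 *: clip C v) ^+ 2 / (C * s / m%:R) ^+ 2 <= s ^-2.
  move=> C0 s0; rewrite norm2Z gtr0_norm ?invr_gt0//.
  rewrite -expr_div_n -exprVn ler_sqr ?nnegrE ?invr_ge0 ?(ltW s0)//; last first.
    apply: divr_ge0; last by rewrite ltW// divr_gt0// mulr_gt0.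
    by rewrite mulr_ge0 ?norm2_ge0// invr_ge0 ltW.
  rewrite ler_pdivrMr ?divr_gt0 ?mulr_gt0//.
  have -> : s^-1 * (C * s / m%:R) = m%:R^-1 * C.
    by field; rewrite !gt_eqF.
  by rewrite ler_pM2l ?invr_gt0// norm2_clip_le.
pose dx := m%:R^-1 *: (clipped_record r).1.
pose dy := m%:R^-1 *: (clipped_record r).2.
exists (Num.sqrt (norm2 dx ^+ 2 / (Cx * sigx / m%:R) ^+ 2 +
  norm2 dy ^+ 2 / (Cy * sigy / m%:R) ^+ 2)).
  by rewrite sqrtr_ge0/= ler_wsqrtr// lerD// bound.
(* The multiplier is left open and fixed by unification with the exponential in
   [gauss_pair_shift_le]. *)
move=> t; eexists; last first => [v|].
  rewrite /release_E /= !scalerDr ![_ *: clip _ _ + _]addrC.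
  apply: gauss_pair_shift_le => //.
  - by rewrite gt_eqF// divr_gt0// mulr_gt0.
  - by rewrite gt_eqF// divr_gt0// mulr_gt0.
exact: expR_gt0.
Qed.

End mixture.
End dpfmix.

Theorem mainTheorem2 (R : realType) (X : Type) (d k : nat) (f1 : X -> 'rV[R]_d)
  (Cx Cy sigx sigy : R) (m n : nat) :
  0 < Cx -> 0 < Cy -> 0 < sigx -> 0 < sigy -> (1 <= m)%N -> (m <= n)%N ->
  forall (S1 S2 : seq (X * 'rV[R]_k)) (r : X * 'rV[R]_k),
  let p := m%:R / n%:R in
  let S := S1 ++ S2 in
  let S' := S1 ++ r :: S2 in
  forall alpha : R, 0 <= alpha <= 1 ->
  ((p * Gmu (Num.sqrt (sigx ^-2 + sigy ^-2)) alpha + (1 - p) * (1 - alpha))%:E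
   <= tradeoff (dpfmix_E f1 Cx Cy sigx sigy m p S)
               (dpfmix_E f1 Cx Cy sigx sigy m p S') alpha)%E.
Proof.
move=> Cx0 Cy0 sx0 sy0 m0 mn S1 S2 r p S S' alpha /andP[a0 a1].
have p01 : 0 <= p <= 1.
  rewrite divr_ge0//= ler_pdivrMr ?mul1r ?ler_nat//.
  by rewrite ltr0n (leq_trans m0).
have /andP[p0 p1] := p01.
apply: le_ereal_inf_tmp => _ [phi [rphi EPphi] <-].
move: EPphi; rewrite !dpfmix_sampE// -EFinB !lee_fin /S' sampE_insert -/S.
set u := clipped_record _ _ _; set F := release_E _ _ _ _ _ phi.
(* [a] is the rejection probability on [S], and [b] the one on [S'] given that [r] is sampled. *)
set a := sampE u p S F; set b := sampE u p S _ => aa.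
have [mu /andP[mu0 mule] H] :=
  release_E_shift_le f1 r rphi Cx0 Cy0 sx0 sy0 m0.
have {}H t : exists2 lam, 0 < lam &
    b <= lam * a + ((1 - Phi (t - mu)) - lam * (1 - Phi t)).
  have [lam lam0 Hlam] := H t; exists lam => //.
  exact: sampE_le_affine.
have F01 v : 0 <= F v <= 1.
  by have [] := gauss_pair_fin01 (m%:R^-1 *: v.1) (Cx * sigx / m%:R)
    (m%:R^-1 *: v.2) (Cy * sigy / m%:R) rphi.
(* An affine bound of slope 0; it settles [alpha = 1], where [Gmu] is 0. *)
have b1 : b <= 1.
  rewrite -[leRHS]add0r -[X in X + _](mul0r a); apply: sampE_le_affine => // v.
  by rewrite mul0r add0r; have /andP[] := F01 (u r + v).
suff bG : b <= 1 - Gmu (Num.sqrt (sigx ^-2 + sigy ^-2)) alpha.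
  have q0 : 0 <= 1 - p by rewrite subr_ge0.
  have := ler_wpM2l q0 aa; have := ler_wpM2l p0 bG; lra.
rewrite /Gmu; case: (leP alpha 0) => [al0|al0]; last case: (leP 1 alpha) => [al1|al1].
(* At [alpha = 0] the optimal threshold is infinite. Large finite [t] are used instead: [a <= 0]
   makes [lam * a] harmless however large [lam] becomes, and [1 - Phi (t - mu)] drops below [e]. *)
- rewrite subrr; apply/ler_addgt0Pr => e e0; rewrite add0r.
  have [x hx] : exists x, 1 - e < Phi x.
    have e1 : 1 - e < 1 by rewrite gtrBl.
    by have /cvgr_gt/(_ _ e1)/filter_ex := @Phi_cvg1 R.
  have [lam lam0] := H (x + mu); rewrite addrK => /le_trans; apply.
  have : lam * a <= 0 by rewrite pmulr_rle0// (le_trans aa).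
  have : 0 <= lam * (1 - Phi (x + mu)) by rewrite mulr_ge0 ?(ltW lam0)// subr_ge0 Phi_le1.
  lra.
- by rewrite subr0.
- set t := Phi_inv _; have [lam lam0 hb] := H t.
  (* This gives [a <= alpha <= 1 - Phi t], so the two terms carrying [lam] add up to at most 0. *)
  have ht : Phi t <= 1 - alpha by apply: Phi_Phi_inv_le; apply/andP; split; lra.
  (* The record [r] may move the output by less than the worst case; monotonicity of [Phi] passes to
     the worst case. *)
  have hm : Phi (t - Num.sqrt (sigx ^-2 + sigy ^-2)) <= Phi (t - mu).
    by apply: Phi_nondecreasing; rewrite lerB.
  have : lam * a <= lam * (1 - Phi t) by rewrite ler_pM2l//; lra.
  lra.
Qed.
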